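(* The following decision problem $\mathrm{Commutative}$ is in $\mathsf{AC}^0$. Input: transformations $a_1,\dots,a_k \in T_n$. Problem: is the semigroup $\langle a_1,\dots,a_k\rangle$ commutative?
   Context: $T_n$ is the full transformation semigroup on $[n]=\{1,\dots,n\}$: all maps $[n]\to[n]$, acting on the right, under composition (so $q\cdot st=(qs)t$). $\langle a_1,\dots,a_k\rangle$ is the subsemigroup of $T_n$ generated by $a_1,\dots,a_k$ ($k,n\ge 1$). In the input each transformation is given by its table of values, and $k,n$ are part of the input. A semigroup $S$ is commutative if $st=ts$ for all $s,t\in S$. $\mathsf{AC}^0$ is the class of all sets decidable by (polynomial-size) unbounded fan-in Boolean circuits of constant depth. *)

(* Defs.v *)
From HB Require Import structures.
From mathcomp Require Import all_boot.

Set Implicit Arguments.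
Unset Strict Implicit.
Unset Printing Implicit Defensive.

(* Transformations of [n], with points numbered from 0.  They act on the      *)
(* right, so the product s * t applies s first.                               *)
Definition transf (n : nat) := {ffun 'I_n -> 'I_n}.

HB.instance Definition _ n := Finite.on (transf n).

Definition transf_mul n (s t : transf n) : transf n := [ffun q => t (s q)].

Lemma transf_mulA n : associative (@transf_mul n).
Proof. by move=> s t u; apply/ffunP => q; rewrite !ffunE. Qed.

HB.instance Definition _ n := isSemigroup.Build (transf n) (@transf_mulA n).

Inductive generated (G : semigroupType) (A : seq G) : G -> Prop :=
| generated_incl s of s \in A : generated A s
| generated_mul s t of generated A s & generated A t : generated A (s * t)%g.

Definition commutative_sg (G : semigroupType) (S : G -> Prop) :=
  forall s t : G, S s -> S t -> commute s t.

(* A circuit is the list of its gates in topological order: the naturals in   *)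
(* Not, And and Or are positions in that list.  The output is the last gate.  *)
(* And [::] and Or [::] are the constants true and false.                     *)
Inductive gate : Type :=
| Input of nat
| Not of nat
| And of seq nat
| Or of seq nat.

Definition circuit := seq gate.

(* Legality of a gate at position i of a circuit with N inputs. *)
Definition gate_wf (N i : nat) (g : gate) : bool :=
  match g with
  | Input j => j < N
  | Not j => j < i
  | And js | Or js => all (fun j => j < i) js
  end.

Definition circuit_wf (N : nat) (c : circuit) : bool :=
  (0 < size c) &&
  [forall i : 'I_(size c), gate_wf N i (tnth (in_tuple c) i)].

(* Here v lists the values of the preceding gates. *)
Definition gate_val (x v : seq bool) (g : gate) : bool :=
  match g with
  | Input j => nth false x j
  | Not j => ~~ nth false v j
  | And js => all (nth false v) js
  | Or js => has (nth false v) js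
  end.

Definition circuit_vals (x : seq bool) (c : circuit) : seq bool :=
  foldl (fun v g => rcons v (gate_val x v g)) [::] c.

Definition circuit_eval (x : seq bool) (c : circuit) : bool :=
  last false (circuit_vals x c).

(* Depth counts every gate other than inputs, negations included; v lists the *)
(* depths of the preceding gates.                                             *)
Definition gate_depth (v : seq nat) (g : gate) : nat :=
  match g with
  | Input _ => 0
  | Not j => (nth 0 v j).+1
  | And js | Or js => (\max_(j <- js) nth 0 v j).+1
  end.

Definition circuit_depths (c : circuit) : seq nat :=
  foldl (fun v g => rcons v (gate_depth v g)) [::] c.

Definition circuit_depth (c : circuit) : nat := \max_(d <- circuit_depths c) d.

Definition language := seq bool -> Prop.

(* The circuit family is not required to be uniform.  The size of a circuit   *)
(* is its number of gates.                                                    *)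
Definition AC0 (L : language) : Prop :=
  exists (C : nat -> circuit) (d a e : nat), forall N : nat,
    [/\ circuit_wf N (C N),
        circuit_depth (C N) <= d,
        size (C N) <= a * N ^ e + a
      & forall x : N.-tuple bool, circuit_eval x (C N) <-> L x].

(* The w low-order bits of m, least significant first. *)
Definition binary (w m : nat) : seq bool :=
  [seq odd (m %/ 2 ^ i) | i <- iota 0 w].

(* The table of values of s; each entry takes ceil(log2 n) bits. *)
Definition encode_transf n (s : transf n) : seq bool :=
  flatten [seq binary (up_log 2 n) (s q) | q <- enum 'I_n].

(* The unary header 1^k 0 1^n 0 makes the encoding uniquely decodable.  Up to *)
(* constants it is no longer than the tables, except when n = 1, where the    *)
(* tables are empty.                                                          *)
Definition encode_input k n (a : k.-tuple (transf n)) : seq bool :=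
  nseq k true ++ false :: nseq n true ++ false ::
    flatten [seq encode_transf s | s <- a].

(* Words that do not encode an input are not in the language. *)
Definition Commutative : language := fun w =>
  exists (k n : nat) (a : k.-tuple (transf n)),
    [/\ 0 < k, 0 < n, w = encode_input a & commutative_sg (generated a)].

(* Main.v *)
(** A semigroup is commutative as soon as its generators commute pairwise, and
    on tables this is local: for all generators a_i, a_j and points q there are
    points p, r, t with q a_i = p, p a_j = t, q a_j = r and r a_i = t.  For a
    word of length N, the disjunction over all (k, n) with k, n <= N of this
    condition and of the correctness of the unary header is a formula with a
    bounded number of quantifiers over ranges of size at most N + 1, hence a
    circuit of constant depth and polynomial size; the case i = j also checks
    that every table entry is below n. *)

From mathcomp Require Import all_boot zify.
Require Import Defs.

Set Implicit Arguments.
Unset Strict Implicit.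
Unset Printing Implicit Defensive.

(** * Concatenation of circuits *)

(** Relocates a gate so that its circuit can follow [m] other gates. The argument of [Input] is a
    position in the word, not in the gate list, and stays fixed. *)
Definition shift_gate (m : nat) (g : gate) : gate :=
  match g with
  | Input j => Input j
  | Not j => Not (m + j)
  | And js => And [seq m + j | j <- js]
  | Or js => Or [seq m + j | j <- js]
  end.

Definition shift_circuit (m : nat) (c : circuit) : circuit :=
  map (shift_gate m) c.

Lemma nth_cat_addn T (x0 : T) u v j : nth x0 (u ++ v) (size u + j) = nth x0 v j.
Proof. by rewrite nth_cat ltnNge leq_addr addKn. Qed.

Lemma gate_val_shift x u v g :
  gate_val x (u ++ v) (shift_gate (size u) g) = gate_val x v g.
Proof.
case: g => [j|j|js|js] //=; first by rewrite nth_cat_addn.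
- by rewrite all_map; apply: eq_all => j /=; rewrite nth_cat_addn.
- by rewrite has_map; apply: eq_has => j /=; rewrite nth_cat_addn.
Qed.

Lemma gate_depth_shift u v g :
  gate_depth (u ++ v) (shift_gate (size u) g) = gate_depth v g.
Proof.
case: g => [j|j|js|js] //=; first by rewrite nth_cat_addn.
- by rewrite big_map; under eq_bigr do rewrite nth_cat_addn.
- by rewrite big_map; under eq_bigr do rewrite nth_cat_addn.
Qed.

(** Kept generic in [F] because gate values and gate depths are computed by the same fold. *)
Lemma foldl_gates_shift T (F : seq T -> gate -> T) u v c :
  (forall v g, F (u ++ v) (shift_gate (size u) g) = F v g) ->
  foldl (fun v g => rcons v (F v g)) (u ++ v) (shift_circuit (size u) c) =
  u ++ foldl (fun v g => rcons v (F v g)) v c.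
Proof.
move=> FE; elim: c v => [|g c IHc] v //=.
by rewrite FE -IHc rcons_cat.
Qed.

Lemma size_foldl_gates T (F : seq T -> gate -> T) v c :
  size (foldl (fun v g => rcons v (F v g)) v c) = size v + size c.
Proof. by elim: c v => [|g c IHc] v /=; rewrite ?addn0 // IHc size_rcons addSnnS. Qed.

Lemma size_circuit_vals x c : size (circuit_vals x c) = size c.
Proof. exact: size_foldl_gates. Qed.

Lemma size_circuit_depths c : size (circuit_depths c) = size c.
Proof. exact: size_foldl_gates. Qed.

Lemma circuit_vals_cat x c1 c2 :
  circuit_vals x (c1 ++ shift_circuit (size c1) c2) =
  circuit_vals x c1 ++ circuit_vals x c2.
Proof.
rewrite /circuit_vals foldl_cat -/(circuit_vals x c1) -(size_circuit_vals x c1).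
by rewrite -{1}[circuit_vals x c1]cats0 foldl_gates_shift // => v g; exact: gate_val_shift.
Qed.

Lemma circuit_depths_cat c1 c2 :
  circuit_depths (c1 ++ shift_circuit (size c1) c2) =
  circuit_depths c1 ++ circuit_depths c2.
Proof.
rewrite /circuit_depths foldl_cat -/(circuit_depths c1) -(size_circuit_depths c1).
by rewrite -{1}[circuit_depths c1]cats0 foldl_gates_shift // => v g; exact: gate_depth_shift.
Qed.

Lemma circuit_depth_cat c1 c2 :
  circuit_depth (c1 ++ shift_circuit (size c1) c2) =
  maxn (circuit_depth c1) (circuit_depth c2).
Proof. by rewrite /circuit_depth circuit_depths_cat big_cat. Qed.

Lemma circuit_vals_rcons x c g :
  circuit_vals x (rcons c g) =
  rcons (circuit_vals x c) (gate_val x (circuit_vals x c) g).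
Proof. by rewrite /circuit_vals -cats1 foldl_cat. Qed.

Lemma circuit_depth_rcons c g :
  circuit_depth (rcons c g) =
  maxn (circuit_depth c) (gate_depth (circuit_depths c) g).
Proof.
by rewrite /circuit_depth /circuit_depths -cats1 foldl_cat /= -cats1 big_cat big_seq1.
Qed.

Lemma nth_circuit_depths c j : nth 0 (circuit_depths c) j <= circuit_depth c.
Proof.
have [lt_j|le_j] := ltnP j (size (circuit_depths c)); last by rewrite nth_default.
by apply: (leq_bigmax_seq (F := id)); rewrite // mem_nth.
Qed.

(** Dropping nonemptiness lets the empty circuit start an induction on concatenations. *)
Definition gates_wf (N : nat) (c : circuit) : Prop :=
  forall i, i < size c -> gate_wf N i (nth (Input 0) c i).

Lemma circuit_wfP N c : circuit_wf N c <-> 0 < size c /\ gates_wf N c.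
Proof.
rewrite /circuit_wf; split=> [/andP[c_gt0 /forallP wf_c]|[-> wf_c]].
  split=> // i lt_i; have := wf_c (Ordinal lt_i).
  by rewrite (tnth_nth (Input 0)).
by apply/forallP=> i; rewrite (tnth_nth (Input 0)); apply: wf_c.
Qed.

Lemma gate_wf_shift N m i g : gate_wf N i g -> gate_wf N (m + i) (shift_gate m g).
Proof.
case: g => [j|j|js|js] //=; first by rewrite ltn_add2l.
- by rewrite all_map; apply: sub_all => j /=; rewrite ltn_add2l.
- by rewrite all_map; apply: sub_all => j /=; rewrite ltn_add2l.
Qed.

Lemma gates_wf_cat N c1 c2 :
  gates_wf N c1 -> gates_wf N c2 -> gates_wf N (c1 ++ shift_circuit (size c1) c2).
Proof.
move=> wf1 wf2 i; rewrite size_cat size_map nth_cat => lt_i.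
have [/wf1//|le_i] := ltnP i (size c1).
have lt_i2 : i - size c1 < size c2 by lia.
rewrite (nth_map (Input 0)) // -{1}(subnKC le_i).
exact/gate_wf_shift/wf2.
Qed.

Lemma gates_wf_rcons N c g :
  gates_wf N c -> gate_wf N (size c) g -> gates_wf N (rcons c g).
Proof.
move=> wf_c wf_g i; rewrite size_rcons nth_rcons ltnS leq_eqVlt.
by case/predU1P=> [->|lt_i]; [rewrite ltnn eqxx | rewrite lt_i; apply: wf_c].
Qed.

(** * Constant-depth circuits for logical connectives and slices *)

(* A sigma type rather than an existential, so that circuits for all input    *)
(* lengths can be collected into a family without choice.                     *)
Definition circuit_for (N d c e : nat) (f : seq bool -> bool) : Type :=
  {C : circuit | [/\ circuit_wf N C, circuit_depth C <= d, size C <= c * N.+1 ^ e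
     & forall x, size x = N -> circuit_eval x C = f x]}.

Lemma circuit_for_ext N d c e f g :
  (forall x, size x = N -> f x = g x) ->
  circuit_for N d c e f -> circuit_for N d c e g.
Proof. by move=> fg [C [wfC dC sC evC]]; exists C; split=> // x Nx; rewrite evC ?fg. Qed.

Lemma circuit_for_mono N d c e d' c' e' f :
  d <= d' -> c <= c' -> e <= e' ->
  circuit_for N d c e f -> circuit_for N d' c' e' f.
Proof.
move=> dd cc ee [C [wfC dC sC evC]]; exists C; split=> //.
  exact: leq_trans dC dd.
by apply: leq_trans sC _; rewrite leq_mul // leq_pexp2l.
Qed.

Lemma circuit_for_input N j : j < N -> circuit_for N 0 1 0 (fun x => nth false x j).
Proof.
move=> lt_j; exists [:: Input j]; split=> //; last by rewrite /circuit_depth big_seq1.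
by apply/circuit_wfP; split=> // -[].
Qed.

Lemma circuit_for_not N d c e f :
  circuit_for N d c e f -> circuit_for N d.+1 c.+1 e (fun x => ~~ f x).
Proof.
case=> C [/circuit_wfP[C_gt0 wfC] dC sC evC].
exists (rcons C (Not (size C).-1)); split.
- apply/circuit_wfP; split; first by rewrite size_rcons.
  by apply: gates_wf_rcons => //=; rewrite prednK.
- rewrite circuit_depth_rcons geq_max (leqW dC) /= ltnS.
  exact: leq_trans (nth_circuit_depths _ _) dC.
(* The new gate is paid for by raising [c] by one: the base [N.+1] makes the power at least 1, even
   for [N = 0]. *)
- by rewrite size_rcons mulSn -add1n leq_add // expn_gt0.
move=> x Nx; rewrite /circuit_eval circuit_vals_rcons last_rcons /=.
by rewrite -(size_circuit_vals x) nth_last -[last _ _]/(circuit_eval x C) evC.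
Qed.

(** Juxtaposed circuits do not read each other's gates, so sizes add up while the depth is only a
    maximum. The list [js] records where the outputs are. *)
Lemma circuits_side_by_side N d s (I : Type) (r : seq I) (f : I -> seq bool -> bool) :
  (forall i, {C : circuit | [/\ circuit_wf N C, circuit_depth C <= d, size C <= s
     & forall x, size x = N -> circuit_eval x C = f i x]}) ->
  {D : circuit & {js : seq nat |
    [/\ gates_wf N D, all (fun j => j < size D) js, circuit_depth D <= d,
        size D <= size r * s
      & forall x, size x = N ->
          [seq nth false (circuit_vals x D) j | j <- js] = [seq f i x | i <- r]]}}.
Proof.
move=> Cf; elim: r => [|i r [D [js [wfD jsD dD sD evD]]]].
  by exists [::], [::]; split=> //; rewrite /circuit_depth big_nil.
have [C [/circuit_wfP[C_gt0 wfC] dC sC evC]] := Cf i.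
(* The output of [C] is its last gate; the outputs of [D] move by [size C]. *)
exists (C ++ shift_circuit (size C) D), ((size C).-1 :: [seq size C + j | j <- js]).
split.
- exact: gates_wf_cat.
- rewrite /= size_cat size_map all_map; apply/andP; split; first by lia.
  by apply: sub_all jsD => j /=; rewrite ltn_add2l.
- by rewrite circuit_depth_cat geq_max dC.
- by rewrite size_cat size_map mulSn leq_add.
move=> x Nx; rewrite /= circuit_vals_cat nth_cat size_circuit_vals prednK // leqnn.
rewrite -{1}(size_circuit_vals x) nth_last -[last _ _]/(circuit_eval x C) evC //.
rewrite -map_comp -evD //; congr cons; apply: eq_map => j /=.
by rewrite -(size_circuit_vals x) nth_cat_addn.
Qed.

(** Unbounded fan-in enters here: one [And] gate joins all the outputs, so the depth grows by one
    however long [r] is. *)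
Lemma circuit_for_all N d c e k a (I : Type) (r : seq I) (f : I -> seq bool -> bool) :
  size r <= k * N.+1 ^ a -> (forall i, circuit_for N d c e (f i)) ->
  circuit_for N d.+1 (k * c).+1 (a + e) (fun x => all (fun i => f i x) r).
Proof.
move=> r_le /(circuits_side_by_side r)[D [js [wfD jsD dD sD evD]]].
exists (rcons D (And js)); split.
- by apply/circuit_wfP; split; [rewrite size_rcons | apply: gates_wf_rcons].
- rewrite circuit_depth_rcons geq_max (leqW dD) /= ltnS.
  by apply/bigmax_leqP_seq => j _ _; apply: leq_trans (nth_circuit_depths _ _) dD.
- rewrite size_rcons mulSn -add1n leq_add ?expn_gt0 //.
  by apply: leq_trans sD _; rewrite expnD mulnACA leq_mul2r r_le orbT.
move=> x Nx; rewrite /circuit_eval circuit_vals_rcons last_rcons /=.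
by rewrite -[LHS](all_map _ id) evD // all_map.
Qed.

Lemma circuit_for_forall N d c e m (f : 'I_m -> seq bool -> bool) :
  m <= N.+1 -> (forall i, circuit_for N d c e (f i)) ->
  circuit_for N d.+1 c.+1 e.+1 (fun x => [forall i, f i x]).
Proof.
move=> m_le Cf.
apply: (circuit_for_ext (f := fun x => all (fun i => f i x) (enum 'I_m))).
  by move=> x _; apply/allP/forallP => fx i *; apply: fx; rewrite ?mem_enum.
rewrite -(mul1n c) -(add1n e); apply: circuit_for_all => //.
by rewrite size_enum_ord mul1n expn1.
Qed.

(** De Morgan: the two negations and the conjunction account for the three extra levels. *)
Lemma circuit_for_exists N d c e m (f : 'I_m -> seq bool -> bool) :
  m <= N.+1 -> (forall i, circuit_for N d c e (f i)) ->
  circuit_for N d.+3 c.+3 e.+1 (fun x => [exists i, f i x]).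
Proof.
move=> m_le Cf.
apply: (circuit_for_ext (f := fun x => ~~ [forall i, ~~ f i x])).
  by move=> x _; rewrite negb_forall; apply: eq_existsb => i; rewrite negbK.
apply/circuit_for_not/circuit_for_forall => // i.
exact: circuit_for_not.
Qed.

Lemma circuit_for_const N d c e b : circuit_for N d.+2 c.+2 e (fun _ => b).
Proof.
have Ctrue : circuit_for N 1 1 0 (fun _ => true).
  by exists [:: And [::]]; split=> //; [apply/circuit_wfP; split=> // -[] |
     rewrite /circuit_depth big_seq1 /= big_nil].
case: b; first exact: circuit_for_mono Ctrue.
exact: circuit_for_mono (circuit_for_not Ctrue).
Qed.

Lemma circuit_for_and N d1 c1 e1 d2 c2 e2 f1 f2 :
  circuit_for N d1 c1 e1 f1 -> circuit_for N d2 c2 e2 f2 ->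
  circuit_for N (d1 + d2).+1 (2 * (c1 + c2)).+1 (e1 + e2) (fun x => f1 x && f2 x).
Proof.
move=> Cf1 Cf2.
(* A binary conjunction is a conjunction indexed by the booleans; the sums of the parameters serve
   as common bounds for both conjuncts. *)
pose f (b : bool) := if b then f1 else f2.
apply: (circuit_for_ext (f := fun x => all (fun b => f b x) [:: true; false])).
  by move=> x _; rewrite /= andbT.
rewrite -[e1 + e2]add0n; apply: circuit_for_all => // -[].
  by apply: circuit_for_mono Cf1; rewrite leq_addr.
by apply: circuit_for_mono Cf2; rewrite leq_addl.
Qed.

(** The condition [b] does not depend on the word, so it is decided while the circuit is built, and
    [f] has to be realized only when [b] holds. *)
Lemma circuit_for_guard N d c e (b : bool) f :
  (b -> circuit_for N d c e f) -> circuit_for N d.+2 c.+2 e (fun x => b && f x).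
Proof.
case: b => [Cf|_]; last exact: circuit_for_const.
by apply: circuit_for_mono (Cf isT); rewrite // ltnW.
Qed.

(** A position past the end of the word reads the default [false] and gets a constant circuit, so
    slices can be compared at any offset. *)
Lemma circuit_for_bit N j (b : bool) : circuit_for N 3 3 0 (fun x => nth false x j == b).
Proof.
have Cj : circuit_for N 2 2 0 (fun x => nth false x j).
  have [lt_j|le_j] := ltnP j N.
    exact: circuit_for_mono (circuit_for_input lt_j).
  apply: (circuit_for_ext (f := fun _ => false)); last exact: circuit_for_const.
  by move=> x Nx; rewrite nth_default // Nx.
case: b; last first.
  by apply: circuit_for_ext (circuit_for_not Cj) => x _; rewrite eqbF_neg.
by apply: circuit_for_mono (circuit_for_ext _ Cj) => // x _; rewrite eqb_id.
Qed.

Definition slice (o w : nat) (x : seq bool) : seq bool :=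
  mkseq (fun b => nth false x (o + b)) w.

Lemma circuit_for_slice N o w y :
  w <= N.+1 -> circuit_for N 6 6 1 (fun x => slice o w x == y).
Proof.
move=> w_le.
apply: (circuit_for_ext (f := fun x =>
    (size y == w) && [forall b : 'I_w, nth false x (o + b) == nth false y b])).
  move=> x _; apply/andP/eqP => [[/eqP sy /forallP xy]|<-].
    apply: (@eq_from_nth _ false); rewrite size_mkseq // => b lt_b.
    by rewrite nth_mkseq //; apply/eqP/(xy (Ordinal lt_b)).
  by rewrite size_mkseq; split=> //; apply/forallP=> b; rewrite nth_mkseq.
apply: circuit_for_guard => _; apply: circuit_for_forall => // b.
exact: circuit_for_bit.
Qed.

(** * The bit layout of an encoded input *)

Lemma nth_flatten_const T (x0 : T) w ss i b :
  all (fun s => size s == w) ss -> b < w ->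
  nth x0 (flatten ss) (i * w + b) = nth x0 (nth [::] ss i) b.
Proof.
move=> + lt_b; elim: ss i => [|s ss IHss] i /=; first by rewrite !nth_nil.
case/andP=> /eqP sw /IHss{}IHss; case: i => [|i] /=.
  by rewrite nth_cat sw lt_b.
by rewrite mulSn -addnA -{1}sw nth_cat_addn IHss.
Qed.

Lemma size_flatten_const T w (ss : seq (seq T)) :
  all (fun s => size s == w) ss -> size (flatten ss) = size ss * w.
Proof.
elim: ss => [|s ss IHss] //= /andP[/eqP sw /IHss{}IHss].
by rewrite size_cat IHss sw mulSn.
Qed.

Lemma size_binary w m : size (binary w m) = w.
Proof. by rewrite size_map size_iota. Qed.

Lemma binary_inj w m m' : m < 2 ^ w -> m' < 2 ^ w -> binary w m = binary w m' -> m = m'.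
Proof.
(* Peeling off the least significant bit turns injectivity into an induction on the width. *)
have binaryS v p : binary v.+1 p = odd p :: binary v p./2.
  rewrite /binary -[v.+1]add1n iotaD map_cat /= divn1 (iotaDl 1) -map_comp.
  by congr cons; apply: eq_map => i /=; rewrite expnS divnMA divn2.
elim: w m m' => [|w IHw] m m'; first by rewrite expn0 !ltnS !leqn0 => /eqP-> /eqP->.
rewrite !expnS !binaryS => lt_m lt_m' [odd_mm' /IHw half_mm'].
rewrite -(odd_double_half m) -(odd_double_half m') odd_mm' half_mm' //.
  by rewrite -divn2 ltn_divLR // mulnC.
by rewrite -divn2 ltn_divLR // mulnC.
Qed.

Definition header (k n : nat) : seq bool :=
  nseq k true ++ false :: nseq n true ++ [:: false].

Lemma size_header k n : size (header k n) = k + n + 2.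
Proof. by rewrite !(size_cat, size_nseq, size_cat) /= size_cat size_nseq /=; lia. Qed.

Definition width (n : nat) := up_log 2 n.

Lemma ltn_width n (p : 'I_n) : p < 2 ^ width n.
Proof. exact: leq_trans (ltn_ord p) (up_logP _ _). Qed.

Lemma width_leq n : width n <= n.
Proof. by apply: up_log_min => //; rewrite ltnW // ltn_expl. Qed.

Lemma all_size_binary n (s : transf n) :
  all (fun b => size b == width n) [seq binary (width n) (s q) | q <- enum 'I_n].
Proof. by rewrite all_map; apply/allP => q _ /=; rewrite size_binary. Qed.

Lemma size_encode_transf n (s : transf n) : size (encode_transf s) = n * width n.
Proof. by rewrite (size_flatten_const (all_size_binary s)) size_map size_enum_ord. Qed.

Lemma all_size_encode_transf k n (a : k.-tuple (transf n)) :
  all (fun b => size b == n * width n) [seq encode_transf s | s <- a].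
Proof. by rewrite all_map; apply/allP => s _ /=; rewrite size_encode_transf. Qed.

Lemma encode_inputE k n (a : k.-tuple (transf n)) :
  encode_input a = header k n ++ flatten [seq encode_transf s | s <- a].
Proof. by rewrite /encode_input /header -!catA /= -!catA. Qed.

Lemma size_encode_input k n (a : k.-tuple (transf n)) :
  size (encode_input a) = k + n + 2 + k * n * width n.
Proof.
rewrite encode_inputE size_cat size_header (size_flatten_const (all_size_encode_transf a)).
by rewrite size_map size_tuple mulnA.
Qed.

Lemma nth_encode_input k n (a : k.-tuple (transf n)) (i : 'I_k) (q : 'I_n) b :
  b < width n ->
  nth false (encode_input a) (k + n + 2 + (i * n + q) * width n + b) =
  nth false (binary (width n) (tnth a i q)) b.
Proof.
move=> lt_b; rewrite encode_inputE -size_header -addnA nth_cat_addn.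
have -> : (i * n + q) * width n + b = i * (n * width n) + (q * width n + b) by lia.
have lt_qb : q * width n + b < n * width n.
  by apply: leq_trans (leq_mul (ltn_ord q) (leqnn _)); rewrite mulSn; lia.
rewrite nth_flatten_const ?all_size_encode_transf //.
rewrite (nth_map (tnth a i)) ?size_tuple // -tnth_nth.
rewrite nth_flatten_const ?all_size_binary //.
by rewrite (nth_map q) ?size_enum_ord // nth_ord_enum.
Qed.

Definition entry (k n i q : nat) : seq bool -> seq bool :=
  slice (k + n + 2 + (i * n + q) * width n) (width n).

(** Breaks equality with an encoding into tests on slices at offsets that depend only on [k], [n]
    and the indices. Conversely, two Euclidean divisions assign each position after the header to a
    generator, a point and a bit. *)
Lemma encode_inputP k n (a : k.-tuple (transf n)) x :
  x = encode_input a <->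
  [/\ size x = k + n + 2 + k * n * width n, slice 0 (k + n + 2) x = header k n
    & forall (i : 'I_k) (q : 'I_n), entry k n i q x = binary (width n) (tnth a i q)].
Proof.
split=> [->|[sx hx ex]].
  split; first exact: size_encode_input.
    apply: (@eq_from_nth _ false); rewrite size_mkseq ?size_header // => b lt_b.
    by rewrite nth_mkseq // encode_inputE nth_cat size_header lt_b.
  move=> i q; apply: (@eq_from_nth _ false); rewrite size_mkseq ?size_binary // => b lt_b.
  by rewrite nth_mkseq // nth_encode_input.
apply: (@eq_from_nth _ false); rewrite ?size_encode_input // sx => m lt_m.
have [lt_mh|le_hm] := ltnP m (k + n + 2).
  by rewrite encode_inputE nth_cat size_header lt_mh -hx nth_mkseq.
rewrite -(subnKC le_hm); move: (m - _) (subnKC le_hm) lt_m => {le_hm}m' <-.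
rewrite ltn_add2l => lt_m.
(* A position after the header exists only if the tables are nonempty, so both divisors are
   positive; for [n = 1] there is no such position. *)
have w_gt0 : 0 < width n by case: (width n) lt_m => //; rewrite muln0.
have lt_bw : m' %% width n < width n by rewrite ltn_mod.
have n_gt0 : 0 < n by case: (n) lt_m => //; rewrite muln0.
have lt_q : (m' %/ width n) %% n < n by rewrite ltn_mod.
have lt_i : (m' %/ width n) %/ n < k by rewrite !ltn_divLR.
rewrite (divn_eq m' (width n)) (divn_eq (m' %/ width n) n) addnA.
rewrite -[X in (X * n + _) * _]/(val (Ordinal lt_i)) -[X in (_ + X) * _]/(val (Ordinal lt_q)).
by rewrite nth_encode_input // -ex nth_mkseq.
Qed.

(** * Commutativity as a condition on tables *)

Lemma commutative_generatedP (G : semigroupType) (A : seq G) :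
  commutative_sg (generated A) <-> {in A &, forall s t, commute s t}.
Proof.
split=> [comA s t As At|comA s t].
  by apply: comA; apply: generated_incl.
(* The elements commuting with [u] are closed under products; this settles the right argument, and a
   second induction the left one. *)
have comS (u : G) : {in A, forall v, commute u v} -> forall v, generated A v -> commute u v.
  move=> comu v; elim=> [{}v /comu//|v1 v2 _ com1 _ com2].
  exact: commuteM.
elim=> [{}s As|s1 s2 _ com1 _ com2] At.
  by apply: comS => // v Av; apply: comA.
by apply/commute_sym/commuteM; apply/commute_sym; [apply: com1 | apply: com2].
Qed.

(** The intermediate points are quantified, so that every atom compares a slice at a fixed offset
    with a fixed word, as [circuit_for_slice] requires. *)
Definition commuting_tables (k n : nat) (x : seq bool) : bool :=
  [forall i : 'I_k, [forall j : 'I_k, [forall q : 'I_n,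
   [exists p : 'I_n, [exists r : 'I_n, [exists t : 'I_n,
     ((entry k n i q x == binary (width n) p) && (entry k n j p x == binary (width n) t))
     && ((entry k n j q x == binary (width n) r)
         && (entry k n i r x == binary (width n) t))]]]]]].

(** The arithmetic conditions on [k], [n] and [N] are grouped first, to be handled by
    [circuit_for_guard]. *)
Definition accepts (N : nat) (x : seq bool) : bool :=
  [exists k : 'I_N.+1, [exists n : 'I_N.+1,
    [&& 0 < k, 0 < n & N == k + n + 2 + k * n * width n]
    && ((slice 0 (k + n + 2) x == header k n) && commuting_tables k n x)]].

Lemma commuting_tablesP k n (a : k.-tuple (transf n)) x :
  (forall (i : 'I_k) (q : 'I_n), entry k n i q x = binary (width n) (tnth a i q)) ->
  commuting_tables k n x <-> commutative_sg (generated a).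
Proof.
move=> ex; rewrite commutative_generatedP; split=> [com_x s t /tnthP[i ->] /tnthP[j ->]|com_a].
  apply/ffunP=> q; rewrite !ffunE.
  (* Codes determine points, so the quantified points are forced to be the true images and both
     products send [q] to [u]. *)
  have binI (p p' : 'I_n) : binary (width n) p == binary (width n) p' -> p = p'.
    by move/eqP/binary_inj => pp'; apply/val_inj/pp'; apply: ltn_width.
  have /existsP[p /existsP[r /existsP[u]]] := forallP (forallP (forallP com_x i) j) q.
  by rewrite !ex => /andP[/andP[/binI<- /binI->] /andP[/binI<- /binI->]].
apply/forallP=> i; apply/forallP=> j; apply/forallP=> q.
apply/existsP; exists (tnth a i q); apply/existsP; exists (tnth a j q).
apply/existsP; exists (tnth a j (tnth a i q)); rewrite !ex !eqxx /=.
have /ffunP/(_ q) := com_a _ _ (mem_tnth i a) (mem_tnth j a).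
by rewrite !ffunE => ->.
Qed.

Lemma commuting_tables_valid k n x : commuting_tables k n x ->
  exists a : k.-tuple (transf n),
    forall (i : 'I_k) (q : 'I_n), entry k n i q x = binary (width n) (tnth a i q).
Proof.
move=> com_x.
(* The default [q] is never taken: the diagonal case [j = i] of [com_x] supplies a point whose code
   is the entry. *)
pose a := [tuple [ffun q : 'I_n =>
  odflt q [pick p : 'I_n | entry k n i q x == binary (width n) p]] : transf n | i < k].
exists a => i q; rewrite tnth_mktuple ffunE; case: pickP => [p /eqP//|no_p].
have /existsP[p /existsP[r /existsP[t]]] := forallP (forallP (forallP com_x i) i) q.
by rewrite no_p.
Qed.

Lemma acceptsP N x : size x = N -> accepts N x <-> Commutative x.
Proof.
move=> Nx; split.
  case/existsP=> k /existsP[n /andP[/and3P[k_gt0 n_gt0 /eqP sN] /andP[/eqP hx com_x]]].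
  have [a ex] := commuting_tables_valid com_x.
  exists k, n, a; split=> //; last exact/(commuting_tablesP ex).
  by apply/encode_inputP; split; rewrite ?Nx.
case=> k [n [a [k_gt0 n_gt0 /encode_inputP[sx hx ex] com_a]]].
have lt_k : k < N.+1 by lia.
have lt_n : n < N.+1 by lia.
apply/existsP; exists (Ordinal lt_k); apply/existsP; exists (Ordinal lt_n) => /=.
rewrite k_gt0 n_gt0 -Nx sx hx !eqxx /=.
exact/(commuting_tablesP ex).
Qed.

(** * The circuit family *)

Lemma circuit_for_accepts :
  {d & {c & {e & forall N, circuit_for N d c e (accepts N)}}}.
Proof.
(* The three constants are left open before [N] is introduced, hence cannot depend on it;
   unification with the bounds of the closure lemmas fills them in. *)
do 3!eexists; move=> N.
apply: circuit_for_exists => // k; apply: circuit_for_exists => // n.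
apply: circuit_for_guard => /and3P[_ _ /eqP sN].
have le_k : k <= N.+1 by exact: ltnW.
have le_n : n <= N.+1 by exact: ltnW.
have le_w : width n <= N.+1 by exact: leq_trans (width_leq n) le_n.
(* The guard equation [sN] bounds the header length [k + n + 2] by [N]. *)
apply: circuit_for_and; first by apply: circuit_for_slice; lia.
do 3!(apply: circuit_for_forall => // ?); do 3!(apply: circuit_for_exists => // ?).
by do 2!apply: circuit_for_and; apply: circuit_for_slice.
Qed.

Theorem theorem3p2 : AC0 Commutative.
Proof.
have [d [c [e C]]] := circuit_for_accepts.
(* The factor [2 ^ e] absorbs the passage from [N.+1] to [N], as [N.+1 <= 2 * N] for positive [N];
   for [N = 0] the additive constant suffices. *)
exists (fun N => sval (C N)), d, (c * 2 ^ e), e => N.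
case: (C N) => D [wfD dD sD evD] /=; split=> //; last first.
  by move=> x; rewrite evD ?size_tuple //; apply: acceptsP; rewrite size_tuple.
apply: leq_trans sD _; case: N {C wfD dD evD} => [|N].
  by rewrite exp1n muln1 (leq_trans _ (leq_addl _ _)) // leq_pmulr // expn_gt0.
apply: leq_trans (leq_addr _ _); rewrite -mulnA -expnMn leq_mul2l.
by case: (posnP e) => [->|e_gt0]; rewrite ?expn0 ?orbT // leq_exp2r //; lia.
Qed.
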